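(* In the additive surrogate model, the universal threshold for placement obliviousness is exactly $1$: placement obliviousness holds for all instances with $\rho\le1$, while for every $\varepsilon>0$ some instance with $\rho\le1+\varepsilon$ fails it. Indeed, fix $r_1>0$, set $s=r_1/2$ and $R=r_1+s=\tfrac32 r_1$, let $0<\delta<\min\bigl(\tfrac{r_1}4,\tfrac{\varepsilon r_1}2\bigr)$, pick any $w\in\bigl(\tfrac{r_1}4,\tfrac{r_1}2-\delta\bigr)$, and take $r_2=s$, $r_3=\tfrac{r_1}4+\tfrac{2\delta}3$, $r_4=\tfrac{r_1}4+\tfrac{\delta}3$. Then $r_1>r_2>r_3>r_4$, all four rings form a feasible set (with $\{r_1,r_2\}$ in the pan and $\{r_3,r_4\}$ in the hole of $r_1$), best fit nests $r_2$ in the hole of $r_1$, sends $r_3$ to the pan and cannot place $r_4$ in any container, and $\rho=1+2\delta/r_1\le1+\varepsilon$.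
   Context: Additive surrogate model. Fix a width $w>0$ and a pan of capacity $R>0$. An inventory is a finite list of radii $r_1>r_2>\dots>r_n>0$; the hole of ring $i$ has capacity $r_i-w$ (no hole if $r_i\le w$). A placement of a set $S$ of rings is a forest: each ring of $S$ has as parent either the pan or another ring of $S$, and the radii of the children of each common parent must sum to at most the capacity of that parent's region ($R$ for the pan, $r-w$ for the hole of a ring of radius $r$). $S$ is feasible if it has a placement. The lex-max set $L$ is defined by scanning $i=1,\dots,n$ and including $i$ whenever $(L\cap\{1,\dots,i-1\})\cup\{i\}$ is feasible. A descending greedy execution processes the rings in decreasing radius; when ring $i$ is processed, a container (the pan or the hole of an already placed ring) admits it if the radii of its current children together with $r_i$ sum to at most its capacity; the ring receives some admitting container as its permanent parent (chosen by an arbitrary placement rule), and is skipped only if no container admits it. Best fit chooses the admitting container of smallest capacity. Placement obliviousness holds on an instance if every descending greedy execution places exactly the lex-max set, and fails otherwise. $\rho=\max_i\bigl(\sum_{j>i}r_j\bigr)/r_i$. *)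

(* Defs.v *)
From HB Require Import structures.
From mathcomp Require Import all_boot all_order all_algebra.
From mathcomp Require Import reals.

Set Implicit Arguments.
Unset Strict Implicit.
Unset Printing Implicit Defensive.

Import Order.TTheory GRing.Theory Num.Theory.
Local Open Scope ring_scope.

(* An instance is a ring width [w], a pan capacity [cap] and a tuple [r] of
   strictly decreasing radii. Rings are the indices [i : 'I_n], numbered from 0.
   A container is an [option 'I_n]: [None] is the pan and [Some j] is the hole
   of ring [j]. *)

Definition instance_ok (R : realType) (w cap : R) (n : nat) (r : n.-tuple R) :
    bool :=
  [&& 0 < w, 0 < cap, sorted >%R r & all (fun x => 0 < x) r].

(* The ratios are nonnegative and the one of the last ring is 0, so starting
   the maximum at 0 matters only for the empty inventory. *)
Definition rho (R : realType) (n : nat) (r : n.-tuple R) : R :=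
  \big[Num.max/0]_(i < n) ((\sum_(j < n | (i < j)%N) tnth r j) / tnth r i).

Section AdditiveModel.
Variables (R : realType) (w cap : R) (n : nat) (r : n.-tuple R).

Definition capacity (c : option 'I_n) : R :=
  if c is Some j then tnth r j - w else cap.

(* The containers offered by the pan together with a set [S] of rings; a ring
   of radius at most [w] has no hole. *)
Definition available (S : {set 'I_n}) (c : option 'I_n) : bool :=
  if c is Some j then (j \in S) && (w < tnth r j) else true.

(* The values of the parent map [p] outside [S] are irrelevant. The second
   condition is the forest condition: [obind p] sends a ring to its parent and
   fixes the pan, and with only [n] rings the graph is acyclic iff every ring
   of [S] reaches the pan in at most [n] steps. *)
Definition placement (S : {set 'I_n}) (p : {ffun 'I_n -> option 'I_n}) : bool :=
  [&& [forall i in S, available S (p i)],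
      [forall i in S, iter n (obind p) (Some i) == None]
    & [forall (c | available S c),
         \sum_(i in S | p i == c) tnth r i <= capacity c]].

Definition feasible (S : {set 'I_n}) : bool :=
  [exists p : {ffun 'I_n -> option 'I_n}, placement S p].

Definition lexmax : {set 'I_n} :=
  foldl (fun L i => if feasible (i |: L) then i |: L else L) set0 (enum 'I_n).

(* An execution is recorded by its outcome on each ring: [e i = Some c] if ring
   [i] receives parent [c], and [e i = None] if ring [i] is skipped. Since
   parents are permanent, the state when ring [i] is processed is the
   restriction of [e] to the indices below [i]. *)

Definition placed (e : {ffun 'I_n -> option (option 'I_n)}) : {set 'I_n} :=
  [set i | isSome (e i)].

Definition admits (e : {ffun 'I_n -> option (option 'I_n)}) (i : 'I_n)
    (c : option 'I_n) : bool :=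
  available [set j in placed e | (j < i)%N] c &&
  (\sum_(j < n | (j < i)%N && (e j == Some c)) tnth r j + tnth r i
     <= capacity c).

Definition greedy (e : {ffun 'I_n -> option (option 'I_n)}) : Prop :=
  forall i : 'I_n,
    if e i is Some c then admits e i c else [forall c, ~~ admits e i c].

Definition best_fit (e : {ffun 'I_n -> option (option 'I_n)}) : Prop :=
  greedy e /\
  forall (i : 'I_n) (c c' : option 'I_n),
    e i = Some c -> admits e i c' -> capacity c <= capacity c'.

Definition oblivious : Prop :=
  forall e : {ffun 'I_n -> option (option 'I_n)}, greedy e -> placed e = lexmax.

End AdditiveModel.

Definition universal_threshold (R : realType) (t : R) : Prop :=
  (forall (w cap : R) (n : nat) (r : n.-tuple R),
     instance_ok w cap r -> rho r <= t -> oblivious w cap r) /\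
  (forall eps : R, 0 < eps ->
     exists (w cap : R) (n : nat) (r : n.-tuple R),
       [/\ instance_ok w cap r, rho r <= t + eps & ~ oblivious w cap r]).

(* Main.v *)
Require Import Defs.
From HB Require Import structures.
From mathcomp Require Import all_boot all_order all_algebra.
From mathcomp Require Import reals.
From mathcomp Require Import ring lra.

Set Implicit Arguments.
Unset Strict Implicit.
Unset Printing Implicit Defensive.

Import Order.TTheory GRing.Theory Num.Theory.
Local Open Scope ring_scope.

(** Why the threshold is 1.

    Whatever a greedy execution has built is a placement ([greedy_placement]), so
    it never places a ring that the lex-max scan rejects, and it departs from the
    scan only if it skips a ring [i] such that [i] and the rings placed so far
    have some other placement [p]. Compare [p] with the execution at the first
    ring [j <= i] on which they disagree. Up to [j] they have built the same
    forest, so the container [p j] admitted [j] at the time when [j] was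
    processed. If [j = i] then [i] was not skipped. If [j < i], the execution put
    [j] elsewhere, so from then on the container [p j] keeps a free space of at
    least [r_j] to be shared by the rings that come after [j]. When rho <= 1,
    [r_j] is at least the sum of all later radii, so this container can never
    refuse a later ring; in particular it admits [i], a contradiction
    ([skipped_infeasible]).

    For the sharpness, the four rings of the statement exceed the ratio 1
    slightly: [r3 + r4 = r2 + delta]. Putting 1, 2 in the pan and
    3, 4 in the hole of 1 is a greedy execution that places everything, whereas
    best fit puts 2 in that hole, after which the free space [r2] of the pan
    takes ring 3 but not both 3 and 4. Two greedy executions with different
    outcomes refute obliviousness. *)

(** * Greedy executions and placements *)

Section Greedy.
Variables (R : realType) (w cap : R) (n : nat) (r : n.-tuple R).
Hypothesis r_ok : instance_ok w cap r.

Implicit Types (e : {ffun 'I_n -> option (option 'I_n)})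
  (p : {ffun 'I_n -> option 'I_n}) (S : {set 'I_n}).

Lemma width_gt0 : 0 < w. Proof. by case/and4P: r_ok. Qed.

Lemma radius_gt0 i : 0 < tnth r i.
Proof. by case/and4P: r_ok => _ _ _ /allP; apply; apply: mem_tnth. Qed.

Lemma radius_lt (j k : 'I_n) : tnth r j < tnth r k -> (k < j)%N.
Proof.
case/and4P: r_ok => _ _ r_sorted _; apply: contraTT.
rewrite -leqNgt leq_eqVlt -leNgt => /predU1P[/val_inj-> //|lt_jk].
have gtr_trans : transitive (>%R : rel R).
  by move=> y x z /= yx zy; apply: lt_trans zy yx.
rewrite !(tnth_nth 0) ltW //.
by apply: (sorted_ltn_nth gtr_trans) => //; rewrite inE size_tuple.
Qed.

Lemma capacity_ge0 S c : available w r S c -> 0 <= capacity w cap r c.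
Proof.
case/and4P: r_ok => _ cap0 _ _.
by case: c => [k /andP[_ ltwk]|_] /=; [rewrite subr_ge0 ltW | rewrite ltW].
Qed.

(** A child fits in the hole of its parent, so it is strictly smaller. *)
Lemma placement_parent_lt S p (j k : 'I_n) :
  placement w cap r S p -> j \in S -> p j = Some k -> (k < j)%N.
Proof.
case/and3P=> /forall_inP p_avail _ /forall_inP p_cap jS pj.
apply: radius_lt.
have := p_cap _ (p_avail _ jS); rewrite (bigD1 j) /= ?jS ?eqxx //= pj /=.
have : 0 <= \sum_(i | (i \in S) && (p i == Some k) && (i != j)) tnth r i.
  by apply: sumr_ge0 => i _; apply: ltW; apply: radius_gt0.
have := width_gt0; lra.
Qed.

Lemma decreasing_reach_pan S p :
    (forall j k, j \in S -> p j = Some k -> k \in S /\ (k < j)%N) ->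
  forall j, j \in S -> iter n (obind p) (Some j) == None.
Proof.
move=> p_decr.
have iterN m : iter m (obind p) None = None by elim: m => //= m ->.
have reach m (j : 'I_n) : (j < m)%N -> j \in S -> iter m (obind p) (Some j) = None.
  elim: m j => // m IHm j; rewrite ltnS iterSr /= => le_jm jS.
  case pj: (p j) => [k|]; last exact: iterN.
  have [kS lt_kj] := p_decr _ _ jS pj.
  exact: IHm (leq_trans lt_kj le_jm) kS.
by move=> j jS; rewrite reach.
Qed.

(** The load of a container was checked when its last child arrived and has not
    changed since; parents precede their children, so there are no cycles. *)
Lemma greedy_placement e p (m : nat) :
    greedy w cap r e ->
    (forall j : 'I_n, j \in placed e -> (j < m)%N -> e j = Some (p j)) ->
  placement w cap r [set j in placed e | (j < m)%N] p.
Proof.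
move=> e_greedy e_p; set S := [set j in _ | _].
have admitP j : j \in S -> admits w cap r e j (p j).
  by rewrite inE => /andP[/e_p ej /ej{}ej]; have := e_greedy j; rewrite ej.
have availP j : j \in S ->
    available w r [set k in placed e | (k < j)%N] (p j).
  by move/admitP/andP => [].
apply/and3P; split.
- apply/forall_inP => j jS; have := availP j jS.
  case: (p j) => //= k; rewrite !inE => /andP[/andP[-> lt_kj] ->].
  by move: jS; rewrite inE => /andP[_ /(ltn_trans lt_kj)->].
- apply/forall_inP; apply: decreasing_reach_pan => j k jS pj.
  have := availP j jS; rewrite pj /= !inE => /andP[/andP[-> lt_kj] _].
  by move: jS; rewrite inE => /andP[_ /(ltn_trans lt_kj)->].
- apply/forall_inP => c c_avail.
  have [j0 j0P|S0] := pickP [pred j in S | p j == c]; last first.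
    by rewrite big_pred0 //; apply: capacity_ge0 c_avail.
  have [j /andP[jS /eqP pj] j_max] := arg_maxnP (@nat_of_ord n) j0P.
  have /andP[_] := admitP j jS; rewrite pj; apply: le_trans.
  rewrite (bigD1 j) /= ?jS ?pj ?eqxx // addrC lerD2r.
  rewrite le_eqVlt; apply/orP; left; apply/eqP; apply: eq_bigl => k.
  apply/andP/andP => [[/andP[kS /eqP pk] neq_kj]|[lt_kj /eqP ek]].
    have := j_max k; rewrite inE kS pk eqxx => /(_ isT) le_kj.
    rewrite ltn_neqAle [(k <= j)%N]le_kj andbT; split; first exact: neq_kj.
    by move: kS; rewrite inE => /andP[k_placed k_m]; rewrite e_p ?pk.
  have lt_km : (k < m)%N.
    by move: jS; rewrite inE => /andP[_]; apply: ltn_trans.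
  have kP : k \in placed e by rewrite inE ek.
  have := e_p k kP lt_km; rewrite ek => -[<-].
  by rewrite inE kP lt_km eqxx neq_ltn lt_kj.
Qed.

(** * Obliviousness below ratio 1 *)

Lemma sum_later_radii_le :
  rho r <= 1 -> forall i : 'I_n, \sum_(j < n | (i < j)%N) tnth r j <= tnth r i.
Proof.
move=> rho1 i; rewrite -[leRHS]mul1r -ler_pdivrMr ?radius_gt0 //.
apply: le_trans rho1; rewrite /rho.
exact: (le_bigmax _
  (fun k : 'I_n => (\sum_(j < n | (k < j)%N) tnth r j) / tnth r k)).
Qed.

(** At the first ring [j] on which the execution and a hypothetical placement [p]
    disagree, [p j] is left with room for all the rings after [j], [i] included. *)
Lemma skipped_infeasible e (i : 'I_n) :
    rho r <= 1 -> greedy w cap r e -> i \notin placed e ->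
  ~~ feasible w cap r (i |: [set j in placed e | (j < i)%N]).
Proof.
move=> rho1 e_greedy; rewrite inE => i_skip; apply/existsP => -[p].
set S := i |: _ => p_pl.
have ei : e i = None by case: (e i) i_skip.
have i_refused c : ~~ admits w cap r e i c.
  by have := e_greedy i; rewrite ei => /forallP.
have iS : i \in S by rewrite !inE eqxx.
have i_disagrees : [pred j in S | e j != Some (p j)] i by rewrite /= iS ei.
have [j /andP[jS neq_j] j_min] := arg_minnP (@nat_of_ord n) i_disagrees.
have agree k : k \in S -> (k < j)%N -> e k = Some (p k).
  move=> kS; rewrite ltnNge; apply: contraNeq => neq_k.
  by apply: j_min; rewrite /= kS.
have le_ji : (j <= i)%N.
  by move: jS; rewrite !inE => /predU1P[->//|/andP[_ /ltnW]].
have placedS k : k \in placed e -> (k < j)%N -> k \in S.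
  by move=> kP lt_kj; rewrite in_setU1 in_set kP (leq_trans lt_kj le_ji) orbT.
have pj_admits : admits w cap r e j (p j).
  have /and3P[/forall_inP p_avail _ /forall_inP p_cap] := p_pl.
  have pj_avail := p_avail j jS.
  apply/andP; split.
    case pj: (p j) pj_avail => [k|] //= /andP[kS ->].
    have lt_kj := placement_parent_lt p_pl jS pj.
    rewrite andbT !inE lt_kj andbT.
    by rewrite agree.
  apply: le_trans (p_cap _ pj_avail).
  rewrite [leRHS](bigD1 j) ?jS ?eqxx //= [leLHS]addrC lerD2l.
  rewrite [leLHS]big_mkcond [leRHS]big_mkcond; apply: ler_sum => k _.
  case: ifP => [/andP[lt_kj /eqP ek]|_].
    have kS : k \in S by apply: placedS lt_kj; rewrite inE ek.
    have := agree k kS lt_kj; rewrite ek => -[<-].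
    by rewrite kS eqxx neq_ltn lt_kj.
  by case: ifP => // _; apply/ltW/radius_gt0.
have lt_ji : (j < i)%N.
  rewrite ltn_neqAle le_ji andbT; apply/eqP => /val_inj eq_ji.
  by move: pj_admits; rewrite eq_ji; apply/negP.
have /andP[pj_avail pj_room] := pj_admits.
have /negP[] := i_refused (p j); apply/andP; split.
  case: (p j) pj_avail => //= k; rewrite !inE => /andP[/andP[-> lt_kj] ->].
  by rewrite (ltn_trans lt_kj lt_ji).
apply: le_trans pj_room.
apply: le_trans (lerD (lexx _) (sum_later_radii_le rho1 j)).
(* The load met by [i] comes from the rings before [j] and from those strictly
   between [j] and [i]; the latter and [i] itself are later than [j]. *)
rewrite [X in _ <= _ + X](bigD1 i) //= [leRHS]addrCA [leRHS]addrC lerD2r.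
rewrite [leLHS]big_mkcond [X in _ <= X + _]big_mkcond.
rewrite [X in _ <= _ + X]big_mkcond -big_split /=; apply: ler_sum => k _.
have rk0 := ltW (radius_gt0 k).
case: (ltngtP k j) => [lt_kj|lt_jk|/val_inj->] /=.
- by rewrite (ltn_trans lt_kj lt_ji) /= addr0.
- rewrite add0r -val_eqE /=; case: (ltngtP k i) => //= _.
  by case: ifP.
- by rewrite (negPf neq_j) andbF addr0.
Qed.

Lemma prefix_succ S (i : 'I_n) :
  [set j in S | (j < i.+1)%N] =
  if i \in S then i |: [set j in S | (j < i)%N] else [set j in S | (j < i)%N].
Proof.
case: ifP => iS; apply/setP => j;
  rewrite !inE ltnS [(j <= i)%N]leq_eqVlt (_ : (j == i :> nat) = (j == i)) //.
  by have [->|//] := eqVneq j i; rewrite iS.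
by have [->|//] := eqVneq j i; rewrite iS.
Qed.

Lemma lexmax_char S :
    (forall i : 'I_n,
       (i \in S) = feasible w cap r (i |: [set j in S | (j < i)%N])) ->
  lexmax w cap r = S.
Proof.
move=> S_scan; rewrite /lexmax.
have scan m : (m <= n)%N ->
    foldl (fun L i => if feasible w cap r (i |: L) then i |: L else L) set0
      (take m (enum 'I_n)) = [set j in S | (j < m)%N].
  elim: m => [_|m IHm lt_mn].
    by rewrite take0; apply/setP => j; rewrite !inE andbF.
  pose i := Ordinal lt_mn.
  rewrite (take_nth i) ?size_enum_ord // foldl_rcons IHm 1?ltnW //.
  have -> : nth i (enum 'I_n) m = i by apply: val_inj; rewrite /= nth_enum_ord.
  by rewrite (prefix_succ S i) S_scan.
rewrite -[enum _]take_size size_enum_ord scan //.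
by apply/setP => j; rewrite inE ltn_ord andbT.
Qed.

Lemma oblivious_of_rho_le1 : rho r <= 1 -> oblivious w cap r.
Proof.
move=> rho1 e e_greedy; symmetry; apply: lexmax_char => i.
apply/idP/idP => [iP|]; last by apply: contraLR; apply: skipped_infeasible.
apply/existsP; exists [ffun j => odflt None (e j)].
have := prefix_succ (placed e) i; rewrite iP => <-.
apply: greedy_placement => // j; rewrite inE ffunE.
by case: (e j).
Qed.

End Greedy.

(** * The four-ring family *)

Section FourRings.
Variables (R : realType) (r1 delta w : R).
Hypotheses (r1_gt0 : 0 < r1) (delta_gt0 : 0 < delta) (delta_lt : delta < r1 / 4).
Hypotheses (w_gt : r1 / 4 < w) (w_lt : w < r1 / 2 - delta).

Local Notation cap := (r1 + r1 / 2).
Local Notation r :=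
  [tuple r1; r1 / 2; r1 / 4 + 2 * delta / 3; r1 / 4 + delta / 3].
Local Notation i1 := (@Ordinal 4 0 isT).
Local Notation i2 := (@Ordinal 4 1 isT).
Local Notation i3 := (@Ordinal 4 2 isT).
Local Notation i4 := (@Ordinal 4 3 isT).

Implicit Types (e : {ffun 'I_4 -> option (option 'I_4)})
  (p : {ffun 'I_4 -> option 'I_4}).

Lemma ord4_ind (P : 'I_4 -> Prop) :
  P i1 -> P i2 -> P i3 -> P i4 -> forall i, P i.
Proof.
move=> P1 P2 P3 P4 [[|[|[|[|m]]]] lt_m] //.
- by rewrite (bool_irrelevance lt_m isT).
- by rewrite (bool_irrelevance lt_m isT).
- by rewrite (bool_irrelevance lt_m isT).
- by rewrite (bool_irrelevance lt_m isT).
Qed.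

Lemma container4_ind (P : option 'I_4 -> Prop) :
    P None -> P (Some i1) -> P (Some i2) -> P (Some i3) -> P (Some i4) ->
  forall c, P c.
Proof. by move=> P0 P1 P2 P3 P4 [i|//]; elim/ord4_ind: i. Qed.

Lemma sum_ord4 (P : pred 'I_4) (F : 'I_4 -> R) :
  \sum_(i < 4 | P i) F i =
    (if P i1 then F i1 else 0) + (if P i2 then F i2 else 0)
    + (if P i3 then F i3 else 0) + (if P i4 then F i4 else 0).
Proof.
rewrite big_mkcond !big_ord_recl big_ord0 /=. rewrite addr0 !addrA.
by do !congr (_ + _); congr (if P _ then F _ else _); apply: val_inj.
Qed.

Local Ltac lra_params :=
  move: r1_gt0 delta_gt0 delta_lt w_gt w_lt; lra.

Local Ltac decide_admits :=
  rewrite /admits sum_ord4 /= ?inE !(tnth_nth 0) /=;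
  repeat match goal with H : _ = Some _ |- _ => rewrite H end;
  rewrite /= ?andbF ?eqxx ?eqE //=; lra_params.

Lemma four_rings_ok : instance_ok w cap r.
Proof.
apply/and4P; split; rewrite /= ?andbT; lra_params.
Qed.

Lemma four_rings_rho : rho r = 1 + 2 * delta / r1.
Proof.
rewrite /rho !big_ord_recl big_ord0 !sum_ord4 !(tnth_nth 0) /=.
have -> : (0 + 0 + (r1 / 4 + 2 * delta / 3) + (r1 / 4 + delta / 3)) / (r1 / 2)
   = 1 + 2 * delta / r1 by field; lra_params.
have delta_r1 : 0 < delta / r1 by rewrite divr_gt0.
rewrite max_r; last first.
  rewrite le_max; apply/orP; left; rewrite ler_pdivrMr //.
  have -> : (1 + 2 * delta / r1) * r1 = r1 + 2 * delta by field; lra_params.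
  lra_params.
rewrite max_l // !ge_max; apply/and3P; split.
- rewrite ler_pdivrMr; last by lra_params.
  apply: le_trans (_ : 1 * (r1 / 4 + 2 * delta / 3) <= _); first by lra_params.
  by apply: ler_wpM2r; [lra_params | lra].
- by rewrite !addr0 mul0r; lra.
- by lra.
Qed.

Lemma admits_ring1 e c : admits w cap r e i1 c = (c == None).
Proof. by elim/container4_ind: c; decide_admits. Qed.

Lemma admits_ring2 e c : e i1 = Some None ->
  admits w cap r e i2 c = (c == None) || (c == Some i1).
Proof. by move=> e1; elim/container4_ind: c; decide_admits. Qed.

(** The holes of rings 1 and 2 both have free space [r1 / 2 - w < r1 / 4], too
    little for ring 3. *)
Lemma admits_ring3 e c : e i1 = Some None -> e i2 = Some (Some i1) ->
  admits w cap r e i3 c = (c == None).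
Proof. by move=> e1 e2; elim/container4_ind: c; decide_admits. Qed.

(** In the pan rings 3 and 4 would need [r1 / 2 + delta], more than the
    [r1 / 2] beside ring 1; the holes of rings 1 and 2 are still too
    small, and the hole of ring 3 is smaller than that of ring 2. *)
Lemma admits_ring4 e c :
    e i1 = Some None -> e i2 = Some (Some i1) -> e i3 = Some None ->
  admits w cap r e i4 c = false.
Proof. by move=> e1 e2 e3; elim/container4_ind: c; decide_admits. Qed.

Lemma four_rings_best_fit e :
  best_fit w cap r e <->
  [/\ e i1 = Some None, e i2 = Some (Some i1), e i3 = Some None & e i4 = None].
Proof.
split=> [[e_greedy e_best]|[e1 e2 e3 e4]].
  have e1 : e i1 = Some None.
    have := e_greedy i1; case: (e i1) => [c|].
      by rewrite admits_ring1 => /eqP->.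
    by move/forallP/(_ None); rewrite admits_ring1.
  have e2 : e i2 = Some (Some i1).
    have := e_greedy i2; case e2: (e i2) => [c|].
      rewrite admits_ring2 // => /orP[]/eqP c_eq; last by rewrite c_eq.
      have := e_best i2 c (Some i1) e2; rewrite c_eq admits_ring2 // => /(_ isT).
      by rewrite /= (tnth_nth 0) /= => le_cap; exfalso; move: le_cap; lra_params.
    by move/forallP/(_ None); rewrite admits_ring2.
  have e3 : e i3 = Some None.
    have := e_greedy i3; case: (e i3) => [c|].
      by rewrite admits_ring3 // => /eqP->.
    by move/forallP/(_ None); rewrite admits_ring3.
  split=> //; have := e_greedy i4; case: (e i4) => [c|//].
  by rewrite admits_ring4.
split.
  elim/ord4_ind.
  - by rewrite e1 admits_ring1.
  - by rewrite e2 admits_ring2.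
  - by rewrite e3 admits_ring3.
  - by rewrite e4; apply/forallP => c; rewrite admits_ring4.
elim/ord4_ind => c c'.
- by rewrite e1 admits_ring1 => -[<-] /eqP->.
- rewrite e2 admits_ring2 // => -[<-] /orP[]/eqP-> //=.
  by rewrite (tnth_nth 0) /=; lra_params.
- by rewrite e3 admits_ring3 // => -[<-] /eqP->.
- by rewrite e4.
Qed.

(** Following the intended placement is also a greedy execution. *)
Lemma four_rings_all_greedy p :
    p i1 = None -> p i2 = None -> p i3 = Some i1 -> p i4 = Some i1 ->
  greedy w cap r [ffun i => Some (p i)].
Proof.
move=> p1 p2 p3 p4; set e := finfun _.
have e1 : e i1 = Some None by rewrite ffunE p1.
have e2 : e i2 = Some None by rewrite ffunE p2.
have e3 : e i3 = Some (Some i1) by rewrite ffunE p3.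
have e4 : e i4 = Some (Some i1) by rewrite ffunE p4.
by elim/ord4_ind; rewrite ?e1 ?e2 ?e3 ?e4; decide_admits.
Qed.

Lemma four_rings_placement p :
    p i1 = None -> p i2 = None -> p i3 = Some i1 -> p i4 = Some i1 ->
  placement w cap r [set: 'I_4] p.
Proof.
move=> p1 p2 p3 p4.
set e : {ffun 'I_4 -> option (option 'I_4)} := [ffun i => Some (p i)].
have -> : [set: 'I_4] = [set j in placed e | (j < 4)%N].
  by apply/setP => j; rewrite !inE ffunE ltn_ord.
apply: (greedy_placement four_rings_ok).
  exact: four_rings_all_greedy.
by move=> j _ _; rewrite ffunE.
Qed.

Lemma four_rings_feasible : feasible w cap r [set: 'I_4].
Proof.
apply/existsP; exists [ffun i : 'I_4 => if (i < 2)%N then None else Some i1].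
by apply: four_rings_placement; rewrite ffunE.
Qed.

Lemma four_rings_not_oblivious : ~ oblivious w cap r.
Proof.
move=> obl.
(* The outcome of ring 4 is the default value: it is skipped. *)
pose e_bf : {ffun 'I_4 -> option (option 'I_4)} :=
  [ffun i : 'I_4 => nth None [:: Some None; Some (Some i1); Some None] i].
have [bf_greedy _] : best_fit w cap r e_bf.
  by apply/four_rings_best_fit; split; rewrite ffunE.
pose p : {ffun 'I_4 -> option 'I_4} :=
  [ffun i : 'I_4 => if (i < 2)%N then None else Some i1].
have all_greedy : greedy w cap r [ffun i => Some (p i)].
  by apply: four_rings_all_greedy; rewrite ffunE.
have /setP/(_ i4) := etrans (obl _ bf_greedy) (esym (obl _ all_greedy)).
by rewrite !inE !ffunE.
Qed.

End FourRings.

(** * The threshold *)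

Lemma universal_threshold_1 (R : realType) : universal_threshold (1 : R).
Proof.
split=> [w cap n r r_ok rho1|eps eps_gt0]; first exact: oblivious_of_rho_le1.
pose delta : R := Num.min (1 / 8) (eps / 2).
have delta_gt0 : 0 < delta by rewrite lt_min; apply/andP; split; lra.
have delta_le : delta <= 1 / 8 by rewrite ge_min lexx.
have delta_eps : delta <= eps / 2 by rewrite ge_min lexx orbT.
(* The window for [w] is (1/4, 1/2 - delta); this is its midpoint. *)
pose w : R := 3 / 8 - delta / 2.
have r1_gt0 : (0 : R) < 1 := ltr01.
have delta_lt : delta < 1 / 4 by lra.
have w_gt : 1 / 4 < w by rewrite /w; lra.
have w_lt : w < 1 / 2 - delta by rewrite /w; lra.
exists w, (1 + 1 / 2), 4, [tuple 1; 1 / 2; 1 / 4 + 2 * delta / 3; 1 / 4 + delta / 3].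
split.
- exact: four_rings_ok delta_gt0 delta_lt w_gt w_lt.
- by rewrite (four_rings_rho r1_gt0 delta_gt0 delta_lt w_gt w_lt) divr1; lra.
- exact: four_rings_not_oblivious delta_gt0 delta_lt w_gt w_lt.
Qed.

Theorem theorem16 (R : realType) :
  universal_threshold (1 : R) /\
  forall r1 eps delta : R, 0 < r1 -> 0 < eps ->
    0 < delta -> delta < Num.min (r1 / 4) (eps * r1 / 2) ->
    r1 / 4 < r1 / 2 - delta /\
    forall w : R, r1 / 4 < w -> w < r1 / 2 - delta ->
    let s := r1 / 2 in
    let cap := r1 + s in
    let r2 := s in
    let r3 := r1 / 4 + 2 * delta / 3 in
    let r4 := r1 / 4 + delta / 3 in
    let r := [tuple r1; r2; r3; r4] in
    let i1 := @Ordinal 4 0 isT in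
    let i2 := @Ordinal 4 1 isT in
    let i3 := @Ordinal 4 2 isT in
    let i4 := @Ordinal 4 3 isT in
    cap = 3 / 2 * r1 /\
    [/\ r1 > r2, r2 > r3, r3 > r4 & instance_ok w cap r] /\
    feasible w cap r [set: 'I_4] /\
    (forall p : {ffun 'I_4 -> option 'I_4},
       p i1 = None -> p i2 = None -> p i3 = Some i1 -> p i4 = Some i1 ->
       placement w cap r [set: 'I_4] p) /\
    (forall e : {ffun 'I_4 -> option (option 'I_4)},
       best_fit w cap r e <->
       [/\ e i1 = Some None, e i2 = Some (Some i1), e i3 = Some None
         & e i4 = None]) /\
    (forall e : {ffun 'I_4 -> option (option 'I_4)},
       best_fit w cap r e -> forall c : option 'I_4, ~~ admits w cap r e i4 c) /\
    rho r = 1 + 2 * delta / r1 /\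
    rho r <= 1 + eps /\
    ~ oblivious w cap r.
Proof.
split; first exact: universal_threshold_1.
move=> r1 eps delta r1_gt0 eps_gt0 delta_gt0; rewrite lt_min.
case/andP=> delta_lt delta_eps; split; first by lra.
move=> w w_gt w_lt s cap r2 r3 r4 r i1 i2 i3 i4.
split; first by rewrite /cap /s; lra.
split; first by split; [rewrite /r2 /s; lra | rewrite /r2 /s /r3; lra
  | rewrite /r3 /r4; lra | exact: four_rings_ok].
split; first exact: four_rings_feasible.
split; first by move=> p; apply: four_rings_placement.
split; first by move=> e; apply: four_rings_best_fit.
split.
  by move=> e /four_rings_best_fit[] // e1 e2 e3 _ c; rewrite admits_ring4.
have rhoE : rho r = 1 + 2 * delta / r1 by apply: four_rings_rho w_lt.
split; first exact: rhoE.
split; last exact: four_rings_not_oblivious.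
by rewrite rhoE lerD2l ler_pdivrMr //; lra.
Qed.
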